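(* Let $\tau$ be a signature, $\Delta$ an infinite cardinal, $s=(s_i)_{i<\Delta}$ as in the context, and $K$ a class of $\tau$-structures. Then $K$ is axiomatizable by types omissions if and only if $K$ has property (A).
   Context: Fix an infinite cardinal $\Delta$ and a sequence $s=(s_i)_{i<\Delta}$ of natural numbers in which each value occurs $\Delta$ many times. Let $X_i$ ($i<\Delta$) be new relation symbols with arity $s_i$, and $F$ the set of first-order sentences of signature $\tau\cup\{X_i:i<\Delta\}$. A $\Delta$-2-type is a set $p\subseteq F$ such that every finite subset of $p$ has a model and for every $\phi\in F$ either $\phi\in p$ or $\neg\phi\in p$; $S^2_\Delta(\tau)$ is the set of these types. A tuple $\overrightarrow{R_\Delta}=(R_i)_{i<\Delta}$ of relations on a $\tau$-structure $\mathcal A$ is of kind $s$ if $R_i\subseteq A^{s_i}$ for all $i$; then $\mathbf{tp}(\mathcal A,\overrightarrow{R_\Delta})=\{\phi\in F:\langle\mathcal A,R_i\rangle_{i<\Delta}\models\phi\}$ ($X_i$ interpreted by $R_i$). $\mathcal A$ realizes $p$ if $p=\mathbf{tp}(\mathcal A,\overrightarrow{R_\Delta})$ for some $\overrightarrow{R_\Delta}$ of kind $s$, and omits $p$ otherwise. For a class $L$, $\mathbf O(L)$ is the set of $p\in S^2_\Delta(\tau)$ omitted by all members of $L$. $L$ is axiomatizable by types omissions if there is $\Pi\subseteq\mathbf O(L)$ such that every $\tau$-structure not in $L$ realizes some $p\in\Pi$. Property (A) of $K$: whenever $\mathcal A$ is a $\tau$-structure such that for every tuple $\overrightarrow{R_\Delta}$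 of kind $s$ on $\mathcal A$ there exist $\mathcal B\in K$ and a tuple $\overrightarrow{S_\Delta}$ of kind $s$ on $\mathcal B$ such that $\langle\mathcal A,R_i\rangle_{i<\Delta}$ and $\langle\mathcal B,S_i\rangle_{i<\Delta}$ have isomorphic ultrapowers, then $\mathcal A\in K$. *)

(* Defs.v *)
From Stdlib Require List.
From mathcomp Require Import all_boot.
Set Implicit Arguments. Unset Strict Implicit. Unset Printing Implicit Defensive.

Record signature := Signature {
  fsym : Type; farity : fsym -> nat;   (* function symbols (constants: arity 0) *)
  rsym : Type; rarity : rsym -> nat }.

Record structure (tau : signature) := Structure {
  carrier :> Type;
  inhab : carrier;
  fn : forall f : fsym tau, ('I_(farity f) -> carrier) -> carrier;
  rl : forall r : rsym tau, ('I_(rarity r) -> carrier) -> Prop }.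

(** * Formulas of signature tau ∪ {X_i : i < Delta}, X_i of arity s i *)
Section Syntax.
Variables (tau : signature) (D : Type) (s : D -> nat).

Inductive term := Var of nat | App (f : fsym tau) of ('I_(farity f) -> term).

Inductive formula :=
| FEq of term & term
| FRel (r : rsym tau) of ('I_(rarity r) -> term)
| FX (i : D) of ('I_(s i) -> term)
| FNeg of formula
| FAnd of formula & formula
| FEx of nat & formula.

Fixpoint term_vars_in (S : nat -> Prop) (t : term) : Prop :=
  match t with
  | Var n => S n
  | App f a => forall k, term_vars_in S (a k)
  end.

Fixpoint fvars_in (S : nat -> Prop) (phi : formula) : Prop :=
  match phi with
  | FEq t u => term_vars_in S t /\ term_vars_in S u
  | FRel r a => forall k, term_vars_in S (a k)
  | FX i a => forall k, term_vars_in S (a k)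
  | FNeg p => fvars_in S p
  | FAnd p q => fvars_in S p /\ fvars_in S q
  | FEx x p => fvars_in (fun k => k = x \/ S k) p
  end.

Definition sentence (phi : formula) : Prop := fvars_in (fun _ => False) phi.

Definition rel_tuple (A : structure tau) := forall i : D, ('I_(s i) -> A) -> Prop.

Fixpoint eval_term (A : structure tau) (rho : nat -> A) (t : term) : A :=
  match t with
  | Var n => rho n
  | App f a => @fn tau A f (fun k => eval_term rho (a k))
  end.

Fixpoint sat (A : structure tau) (R : rel_tuple A) (rho : nat -> A)
    (phi : formula) : Prop :=
  match phi with
  | FEq t u => eval_term rho t = eval_term rho u
  | FRel r a => @rl tau A r (fun k => eval_term rho (a k))
  | FX i a => R i (fun k => eval_term rho (a k))
  | FNeg p => ~ sat R rho p
  | FAnd p q => sat R rho p /\ sat R rho q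
  | FEx x p => exists b : A, sat R (fun k => if k == x then b else rho k) p
  end.

(* truth of a sentence (the assignment is irrelevant for sentences) *)
Definition models (A : structure tau) (R : rel_tuple A) (phi : formula) : Prop :=
  sat R (fun _ => inhab A) phi.

Definition is_type2 (p : formula -> Prop) : Prop :=
  (forall phi, p phi -> sentence phi) /\
  (forall l : seq formula, (forall phi, List.In phi l -> p phi) ->
     exists (B : structure tau) (S : rel_tuple B),
       forall phi, List.In phi l -> models S phi) /\
  (forall phi, sentence phi -> p phi \/ p (FNeg phi)).

Definition tp (A : structure tau) (R : rel_tuple A) : formula -> Prop :=
  fun phi => sentence phi /\ models R phi.

Definition realizes (A : structure tau) (p : formula -> Prop) : Prop :=
  exists R : rel_tuple A, forall phi, p phi <-> tp R phi.

Definition omits (A : structure tau) (p : formula -> Prop) : Prop :=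
  ~ realizes A p.

Definition omitted_by_all (L : structure tau -> Prop) (p : formula -> Prop) : Prop :=
  is_type2 p /\ forall A, L A -> omits A p.

Definition axiomatizable_by_types_omissions (L : structure tau -> Prop) : Prop :=
  exists Pi : (formula -> Prop) -> Prop,
    (forall p, Pi p -> omitted_by_all L p) /\
    (forall A : structure tau, ~ L A -> exists p, Pi p /\ realizes A p).

Definition ultrafilter (I : Type) (U : (I -> Prop) -> Prop) : Prop :=
  U (fun _ => True) /\ ~ U (fun _ => False) /\
  (forall X Y, U X -> (forall i, X i -> Y i) -> U Y) /\
  (forall X Y, U X -> U Y -> U (fun i => X i /\ Y i)) /\
  (forall X, U X \/ U (fun i => ~ X i)).

(* The ultrapowers <A,R>^I/U and <B,S>^J/V are isomorphic: an isomorphism is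
   given on representatives by h : A^I -> B^J, which induces a well-defined
   bijection of the quotients by =_U, =_V preserving all function symbols,
   all relation symbols of tau, and all X_i (the ultrapower structure being
   the usual one: relations hold iff they hold on a U-large set). *)
Definition iso_ultrapowers (A : structure tau) (R : rel_tuple A) (I : Type)
    (U : (I -> Prop) -> Prop) (B : structure tau) (S : rel_tuple B) (J : Type)
    (V : (J -> Prop) -> Prop) : Prop :=
  exists h : (I -> A) -> (J -> B),
    (forall x y : I -> A, U (fun i => x i = y i) <-> V (fun j => h x j = h y j)) /\
    (forall y : J -> B, exists x : I -> A, V (fun j => h x j = y j)) /\
    (forall (f : fsym tau) (a : 'I_(farity f) -> I -> A),
        V (fun j => h (fun i => @fn tau A f (fun k => a k i)) j
                    = @fn tau B f (fun k => h (a k) j))) /\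
    (forall (r : rsym tau) (a : 'I_(rarity r) -> I -> A),
        U (fun i => @rl tau A r (fun k => a k i)) <->
        V (fun j => @rl tau B r (fun k => h (a k) j))) /\
    (forall (i0 : D) (a : 'I_(s i0) -> I -> A),
        U (fun i => R i0 (fun k => a k i)) <->
        V (fun j => S i0 (fun k => h (a k) j))).

Definition have_iso_ultrapowers (A : structure tau) (R : rel_tuple A)
    (B : structure tau) (S : rel_tuple B) : Prop :=
  exists (I : Type) (U : (I -> Prop) -> Prop) (J : Type) (V : (J -> Prop) -> Prop),
    ultrafilter U /\ ultrafilter V /\ iso_ultrapowers R U S V.

Definition propertyA (K : structure tau -> Prop) : Prop :=
  forall A : structure tau,
    (forall R : rel_tuple A, exists (B : structure tau) (S : rel_tuple B),
        K B /\ have_iso_ultrapowers R S) ->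
    K A.

End Syntax.

Definition equinumerous (X Y : Type) : Prop :=
  exists (f : X -> Y) (g : Y -> X), (forall x, g (f x) = x) /\ (forall y, f (g y) = y).

(* D (the index set of cardinality Delta) is infinite *)
Definition infinite_type (D : Type) : Prop :=
  exists f : nat -> D, forall m n, f m = f n -> m = n.

Definition each_value_Delta_times (D : Type) (s : D -> nat) : Prop :=
  forall n : nat, equinumerous D {i : D | s i = n}.

(* Main.v *)
(** An isomorphism of ultrapowers preserves the truth of sentences, so a structure
with property (A) not in [K] that realizes some [p] in [Pi] would transfer [p] to
a member of [K].  Conversely, if [A] is not in [K], property (A) gives [R] such
that no expansion of a member of [K] has an ultrapower isomorphic to one of
[(A, R)]; by the Keisler-Shelah theorem no such expansion is elementarily
equivalent to [(A, R)], so all members of [K] omit the type of [(A, R)].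

The Keisler-Shelah theorem is proved without GCH.  Let [W] be an infinite set at
least as large as both structures and the language, [I] a set of size [2^|W|], and
take [2^|I|] functions [I -> W] which are independent: any prescription of the
values of at most [|W|] of them is met at some point of [I].  Well-order all
elements of both powers in the least possible type and pair them off one at a time;
a given [a : I -> A] is paired with an independent function not yet used.  All sets
[{i | phi holds of the a's at i iff phi holds of the b's at i}] must generate a
proper filter.  This is kept by requiring that, for some small set of used
functions, finite intersections of these sets contain a point meeting any
prescription on the unused functions.  A new [f] has to agree with each of
few functions [g : I -> W] that select witnesses.  If too many [f] failed,
[|W|] many of them would fail, on disjoint prescriptions, for the same [g] and the
same set of the filter; prescribing a different value in [W] for each of these
leaves no possible value for [g].  Any ultrafilter extending the final filter makes
the pairing an isomorphism. *)

Require Import Defs.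
From mathcomp Require Import all_boot.
From mathcomp Require Import boolp classical_sets wochoice filter.
Set Implicit Arguments. Unset Strict Implicit. Unset Printing Implicit Defensive.

Local Open Scope classical_set_scope.

(** * Cardinality *)

Definition embeds (X Y : Type) : Prop := exists f : X -> Y, injective f.

Lemma embeds_refl X : embeds X X.
Proof. by exists id. Qed.

Lemma embeds_trans Y X Z : embeds X Y -> embeds Y Z -> embeds X Z.
Proof. by move=> [f fI] [g gI]; exists (g \o f); apply: inj_comp. Qed.

(** By Zorn there is a maximal partial bijection between [X] and [Y]; were it total on neither side,
    a pair of missed points could be added. *)
Lemma embeds_total X Y : embeds X Y \/ embeds Y X.
Proof.
pose P (G : set (X * Y)) := forall p q, G p -> G q -> p.1 = q.1 <-> p.2 = q.2.
have [|G [PG maxG]] := @Zorn_bigcup _ P.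
  move=> F FP Ftot p q [U FU Up] [V FV Vq].
  have [UV|VU] := Ftot _ _ FU FV.
  - exact: (FP _ FV) (UV _ Up) Vq.
  - exact: (FP _ FU) Up (VU _ Vq).
have [Gdom|/existsNP[x Gx]] := pselect (forall x, exists y, G (x, y)).
  have [f Gf] := choice Gdom; left; exists f => x x' ff.
  exact/(PG _ _ (Gf x) (Gf x')).
have [Grng|/existsNP[y Gy]] := pselect (forall y, exists x, G (x, y)).
  have [f Gf] := choice Grng; right; exists f => y y' ff.
  exact/(PG _ _ (Gf y) (Gf y')).
exfalso; apply: (maxG (fun p => G p \/ p = (x, y))).
  split; first by move=> p Gp; left.
  by move/(_ _ (or_intror erefl)) => Gxy; apply: Gx; exists y.
move=> [p1 p2] [q1 q2] [Gp|[-> ->]] [Gq|[-> ->]] //=; first exact: (PG _ _ Gp Gq).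
- by split=> E; exfalso; [apply: Gx; exists p2|apply: Gy; exists p1]; rewrite -E.
- by split=> E; exfalso; [apply: Gx; exists q2|apply: Gy; exists q1]; rewrite E.
Qed.

Lemma embeds_prod X X' Y Y' :
  embeds X X' -> embeds Y Y' -> embeds (X * Y) (X' * Y').
Proof.
move=> [f fI] [g gI]; exists (fun p => (f p.1, g p.2)).
by move=> [a b] [c d] [/fI /= -> /gI /= ->].
Qed.

Lemma embeds_sum X X' Y Y' :
  embeds X X' -> embeds Y Y' -> embeds (X + Y) (X' + Y').
Proof.
move=> [f fI] [g gI].
exists (fun p => match p with inl a => inl (f a) | inr b => inr (g b) end).
by move=> [a|a] [b|b] //= [] => [/fI|/gI] ->.
Qed.

Lemma embeds_inl X Y : embeds X (X + Y).
Proof. by exists inl => a b []. Qed.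

Lemma embeds_inr X Y : embeds Y (X + Y).
Proof. by exists inr => a b []. Qed.

Lemma embeds_pow X Y : embeds X Y -> embeds (X -> Prop) (Y -> Prop).
Proof.
move=> [f fI]; exists (fun S y => exists2 x, S x & f x = y) => S S' SS'.
apply/funext => x; apply/propext; split=> Sx.
- have : exists2 x', S x' & f x' = f x by exists x.
  by rewrite (congr1 (@^~ (f x)) SS') => -[x' S'x' /fI <-].
- have : exists2 x', S' x' & f x' = f x by exists x.
  by rewrite -(congr1 (@^~ (f x)) SS') => -[x' S'x' /fI <-].
Qed.

Lemma embeds_powset X : embeds X (X -> Prop).
Proof. by exists (fun x y => x = y) => x y /(congr1 (@^~ y)) /= ->. Qed.

Lemma not_embeds_pow X : ~ embeds (X -> Prop) X.
Proof.
move=> [f fI]; pose S x := exists2 T : X -> Prop, f T = x & ~ T x.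
have [SfS|nS] := pselect (S (f S)).
- by have [T /fI TS] := SfS; rewrite TS; apply.
- by apply: (nS); exists S.
Qed.

Lemma embeds_fun X Y : embeds (X -> Y) (X * Y -> Prop).
Proof.
exists (fun f p => f p.1 = p.2) => f g fg; apply/funext => x.
by have /(congr1 (@^~ (x, g x))) /= -> := fg.
Qed.

(** * Squares of infinite sets *)

Definition graph_on X (G : set (X * X * X)) (x : X) := exists z, G (x, x, z).

(* [G] is the graph of an injection of [S * S] into [S], [S = graph_on G]. *)
Definition square_embedding X (G : set (X * X * X)) :=
  [/\ forall x y, graph_on G x -> graph_on G y -> exists z, G (x, y, z),
      forall x y z, G (x, y, z) -> [/\ graph_on G x, graph_on G y & graph_on G z],
      forall p z z', G (p, z) -> G (p, z') -> z = z' &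
      forall p p' z, G (p, z) -> G (p', z) -> p = p'].

(** Zorn's lemma is applied to the sets [G] whose union with [G0] is a square embedding, so that the
    empty chain is harmless: its union stands for [G0]. *)
Lemma square_embedding_max X (G0 : set (X * X * X)) : square_embedding G0 ->
  exists G, [/\ square_embedding G, G0 `<=` G &
    forall G', square_embedding G' -> G `<=` G' -> G' `<=` G].
Proof.
move=> sG0.
have [|G [sG maxG]] := @Zorn_bigcup _ (fun G => square_embedding (G0 `|` G)).
  move=> F FP Ftot; set U := _ `|` _.
  have common p q : U p -> U q ->
      exists G, [/\ square_embedding G, G p, G q & G `<=` U].
    have sub V : F V -> G0 `|` V `<=` U.
      by move=> FV r [G0r|Vr]; [left|right; exists V].
    move=> [G0p|[V FV Vp]] [G0q|[W FW Wq]].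
    - by exists G0; split=> // r G0r; left.
    - by exists (G0 `|` W); split; [apply: FP|left|right|apply: sub].
    - by exists (G0 `|` V); split; [apply: FP|right|left|apply: sub].
    - have [VW|WV] := Ftot _ _ FV FW.
      + by exists (G0 `|` W); split; [apply: FP|right; apply: VW|right|apply: sub].
      + by exists (G0 `|` V); split; [apply: FP|right|right; apply: WV|apply: sub].
  have graph_onS G x : G `<=` U -> graph_on G x -> graph_on U x.
    by move=> GU [z /GU]; exists z.
  split.
  - move=> x y [zx Ux] [zy Uy].
    have [G [[tot _ _ _] Gx Gy GU]] := common _ _ Ux Uy.
    by have [z /GU] := tot x y (ex_intro _ _ Gx) (ex_intro _ _ Gy); exists z.
  - move=> x y z Up; have [G [[_ fld _ _] Gp _ GU]] := common _ _ Up Up.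
    by have [? ? ?] := fld _ _ _ Gp; split; apply: graph_onS GU _.
  - move=> p z z' Uz Uz'; have [G [[_ _ fct _] Gz Gz' _]] := common _ _ Uz Uz'.
    exact: fct Gz Gz'.
  - move=> p p' z Up Up'; have [G [[_ _ _ inj] Gp Gp' _]] := common _ _ Up Up'.
    exact: inj Gp Gp'.
exists (G0 `|` G); split=> //.
move=> G' sG' GG' p G'p; right; apply: contrapT => nGp.
have G0G' : G0 `|` G' = G'.
  by apply/seteqP; split=> [r [G0r|//]|r G'r]; [apply/GG'; left|right].
apply: (maxG G'); last by rewrite G0G'.
by split=> [r Gr|/(_ _ G'p)//]; apply: GG'; right.
Qed.

(** The map [j] supplies a disjoint copy of the field [S], and the pairs over the doubled field that
    are not pairs over [S] are sent into this copy. For this [q] codes the pair in [S], then codes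
    the result with the tag [e (b, c)], which tells the copies that contain the coordinates, and [j]
    is applied last. *)
Lemma square_embedding_extend X (G : set (X * X * X)) (e : bool * bool -> X)
    (j : X -> X) :
    square_embedding G -> injective e -> (forall b, graph_on G (e b)) ->
    (forall x, graph_on G x -> ~ graph_on G (j x)) ->
    (forall x y, graph_on G x -> graph_on G y -> j x = j y -> x = y) ->
  exists G', [/\ square_embedding G', G `<=` G' & exists p, G' p /\ ~ G p].
Proof.
move=> [tot fld fct inj] eI eS jnS jI; set S := graph_on G in eS jnS jI *.
have /choice[q qP] (p : X * X) : exists z, S p.1 -> S p.2 -> G (p.1, p.2, z).
  have [[S1 S2]|nS] := pselect (S p.1 /\ S p.2).
    by have [z] := tot _ _ S1 S2; exists z.
  by exists p.1 => S1 S2; case: nS.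
have {}qP x y : S x -> S y -> G (x, y, q (x, y)) by exact: (qP (x, y)).
have qS x y : S x -> S y -> S (q (x, y)).
  by move=> Sx Sy; have [_ _ ?] := fld _ _ _ (qP _ _ Sx Sy).
have qI x y x' y' : S x -> S y -> S x' -> S y' ->
    q (x, y) = q (x', y') -> x = x' /\ y = y'.
  move=> Sx Sy Sx' Sy' E; have := qP _ _ Sx Sy; rewrite E => Gq.
  by have [] := inj _ _ _ Gq (qP _ _ Sx' Sy').
pose r (b : bool) x := if b then j x else x.
have rI b x c y : S x -> S y -> r b x = r c y -> b = c /\ x = y.
  move=> Sx Sy; case: b c => [] [] //=.
  - by move/(jI _ _ Sx Sy).
  - by move=> E; case: (jnS x Sx); rewrite E.
  - by move=> E; case: (jnS y Sy); rewrite -E.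
pose new p := exists b c x y, [/\ b || c, S x, S y &
  p = (r b x, r c y, j (q (e (b, c), q (x, y))))].
pose G' p := G p \/ new p.
have newG p z z' : new (p, z) -> ~ G (p, z').
  move=> [b [c [x [y [bc Sx Sy [-> _]]]]]] /fld[Sr Sr' _].
  by case: b c bc Sr Sr' => [] // [] //= _; [case/(jnS _ Sx)|case/(jnS _ Sx)|
     move=> _ /(jnS _ Sy)].
have newG' p p' z : new (p, z) -> ~ G (p', z).
  move=> [b [c [x [y [bc Sx Sy [_ ->]]]]]]; case: p' => x' y' /fld[_ _].
  by apply/jnS/qS => //; apply: qS.
have S'P x : graph_on G' x <-> exists b y, S y /\ x = r b y.
  split=> [[z [Gx|[b [c [y [y' [_ Sy _ [-> _ _]]]]]]]]|[b [y [Sy ->]]]].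
  - by exists false, x; split=> //; exists z.
  - by exists b, y.
  - case: b => /=; last by have [z Gz] := Sy; exists z; left.
    by eexists; right; exists true, true, y, y; split.
exists G'; split; last first.
- set a := e (true, true); have Sa : S a := eS _.
  exists (j a, j a, j (q (a, q (a, a)))); split.
    by right; exists true, true, a, a; split.
  by move=> /fld[/(jnS _ Sa)].
- by move=> p Gp; left.
split.
- move=> _ _ /S'P[b [x [Sx ->]]] /S'P[c [y [Sy ->]]].
  have [bc|] := boolP (b || c); first by eexists; right; exists b, c, x, y; split.
  by case: b c => [] [] //= _; exists (q (x, y)); left; apply: qP.
- move=> x y z [/fld[Sx Sy Sz]|[b [c [x' [y' [_ Sx Sy [-> -> ->]]]]]]].
    by split; apply/S'P; exists false; [exists x|exists y|exists z].
  split; apply/S'P; [by exists b, x'|by exists c, y'|].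
  by exists true, (q (e (b, c), q (x', y'))); split=> //; apply/qS/qS.
- move=> p z z' [Gz|nz] [Gz'|nz'].
  + exact: fct Gz Gz'.
  + by case: (newG _ _ _ nz' Gz).
  + by case: (newG _ _ _ nz Gz').
  + case: nz nz' => [b [c [x [y [_ Sx Sy [-> ->]]]]]].
    move=> [b' [c' [x' [y' [_ Sx' Sy' [E1 E2 ->]]]]]].
    have [-> ->] := rI _ _ _ _ Sx Sx' E1.
    by have [-> ->] := rI _ _ _ _ Sy Sy' E2.
- move=> p p' z [Gz|nz] [Gz'|nz'].
  + exact: inj Gz Gz'.
  + by case: (newG' _ _ _ nz' Gz).
  + by case: (newG' _ _ _ nz Gz').
  + case: nz nz' => [b [c [x [y [_ Sx Sy [-> ->]]]]]].
    move=> [b' [c' [x' [y' [_ Sx' Sy' [-> E]]]]]].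
    have [/eI[-> ->] E'] := qI _ _ _ _ (eS _) (qS _ _ Sx Sy) (eS _) (qS _ _ Sx' Sy')
      (jI _ _ (qS _ _ (eS _) (qS _ _ Sx Sy)) (qS _ _ (eS _) (qS _ _ Sx' Sy')) E).
    by have [-> ->] := qI _ _ _ _ Sx Sy Sx' Sy' E'.
Qed.

(** Take a maximal square embedding, with field [S], above a pairing on a copy of [nat]. By
    maximality the complement of [S] has no room for a copy of [S], so it embeds in [S]. Hence [X]
    embeds in [S + S], thus in [S * S], thus in [S]. *)
Theorem embeds_square X : embeds nat X -> embeds (X * X) X.
Proof.
move=> [i iI].
pose G0 (p : X * X * X) := exists m n : nat, p = (i m, i n, i (pickle (m, n))).
have pickI : injective (@pickle (nat * nat)%type) by apply: pcan_inj pickleK.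
have G0P x : graph_on G0 x <-> exists n, x = i n.
  by split=> [[z [m [_ [-> _ _]]]]|[n ->]]; [exists m|eexists; exists n, n].
have sG0 : square_embedding G0.
  split.
  - by move=> _ _ /G0P[m ->] /G0P[n ->]; eexists; exists m, n.
  - move=> x y z [m [n [-> -> ->]]].
    by split; apply/G0P; eexists.
  - move=> p z z' [m [n [-> ->]]] [m' [n' [/iI -> /iI -> ->]]] //.
  - by move=> p p' z [m [n [-> ->]]] [m' [n' [-> /iI /pickI [-> ->]]]].
have [G [sG G0G maxG]] := square_embedding_max sG0.
pose e b := i (@pickle (bool * bool)%type b).
have eI : injective e by move=> b c /iI /(pcan_inj pickleK).
have eS b : graph_on G (e b).
  by have /G0P[z /G0G] : exists n, e b = i n; [eexists|exists z].
pose S := {x | graph_on G x}; pose Y := {x | ~ graph_on G x}.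
have SS : embeds (S * S) S.
  have [tot fld fct inj] := sG.
  have qP (p : S * S) : exists z : S, G (sval p.1, sval p.2, sval z).
    have [z Gz] := tot _ _ (svalP p.1) (svalP p.2).
    by have [_ _ Sz] := fld _ _ _ Gz; exists (exist _ z Sz).
  have [q qG] := choice qP.
  exists q => -[[x Sx] [y Sy]] [[x' Sx'] [y' Sy']] E.
  have := qG (exist _ x Sx, exist _ y Sy); rewrite E => /= Gq.
  have [xx yy] := inj _ _ _ Gq (qG (_, _)).
  by congr (_, _); apply: eq_exist.
have XS : embeds X S.
  have [[j jI]|YS] := embeds_total S Y.
    exfalso; pose j' x := match pselect (graph_on G x) with
      | left Sx => sval (j (exist _ x Sx)) | right _ => x end.
    have j'E x (Sx : graph_on G x) : j' x = sval (j (exist _ x Sx)).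
      rewrite /j'; case: pselect => // Sx'.
      by congr (sval (j _)); apply: eq_exist.
    have [x Sx|x y Sx Sy|G' [sG' GG' [p [G'p]]]] :=
        @square_embedding_extend _ G e j' sG eI eS.
    - by rewrite j'E; apply: (svalP (j _)).
    - rewrite !j'E => jj; have /jI [//] : j (exist _ x Sx) = j (exist _ y Sy).
      by case: (j _) (j _) jj => [u nu] [v nv] /= uv; apply: eq_exist.
    - by apply; apply: maxG sG' GG' _ G'p.
  apply: (@embeds_trans (S + Y)).
    exists (fun x => match pselect (graph_on G x) with
      | left Sx => inl (exist _ x Sx) | right nSx => inr (exist _ x nSx) end).
    by move=> x y; case: pselect => Sx; case: pselect => Sy // [].
  apply: (@embeds_trans (S + S)); first exact/embeds_sum/YS/embeds_refl.
  apply: embeds_trans SS.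
  pose eS' b := exist _ (e b) (eS b) : S.
  exists (fun p => match p with inl x => (eS' (true, true), x)
    | inr x => (eS' (true, false), x) end).
  by move=> [x|x] [y|y] [] // => [->|/eI|/eI|->].
apply: (embeds_trans (embeds_prod XS XS)); apply: (embeds_trans SS).
by exists sval => -[x Sx] [y Sy] /= xy; apply: eq_exist.
Qed.

Lemma embeds_sub X (P Q : X -> Prop) :
  (forall x, P x -> Q x) -> embeds {x | P x} {x | Q x}.
Proof.
move=> PQ; exists (fun x => exist _ (sval x) (PQ _ (svalP x))).
by move=> [x Px] [y Py] [] /= xy; apply: eq_exist.
Qed.

Section InfiniteTarget.
Variables (Z : Type) (Zinf : embeds nat Z).

Lemma embeds_prod_inf X Y : embeds X Z -> embeds Y Z -> embeds (X * Y) Z.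
Proof.
by move=> XZ YZ; apply: embeds_trans (embeds_prod XZ YZ) (embeds_square Zinf).
Qed.

Lemma embeds_sum_inf X Y : embeds X Z -> embeds Y Z -> embeds (X + Y) Z.
Proof.
move=> [f fI] [g gI]; have [i iI] := Zinf; apply: embeds_trans (embeds_square Zinf).
exists (fun p => match p with inl x => (i 0, f x) | inr y => (i 1, g y) end).
by move=> [x|x] [y|y] [] => [/fI|/iI|/iI|/gI] // ->.
Qed.

Lemma embeds_unit_inf : embeds unit Z.
Proof. by have [i _] := Zinf; exists (fun=> i 0) => -[] []. Qed.

Lemma embeds_option_inf X : embeds X Z -> embeds (option X) Z.
Proof.
move=> XZ; apply: embeds_trans (embeds_sum_inf XZ embeds_unit_inf).
by exists (fun o => if o is Some x then inl x else inr tt) => -[x|] [y|] // [->].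
Qed.

Lemma embeds_seq_inf X : embeds X Z -> embeds (seq X) Z.
Proof.
move=> [f fI]; have [[q qI] [i iI]] := (embeds_square Zinf, Zinf).
pose code := foldr (fun x z => q (f x, z)) (i 0).
apply: embeds_trans (embeds_prod_inf Zinf (embeds_refl Z)).
exists (fun s => (size s, code s)); elim=> [|x s IHs] [|y t] //= [st].
by move/qI => [/fI -> cst]; congr cons; apply: IHs; rewrite st cst.
Qed.

End InfiniteTarget.

Lemma embeds_surj X Y : X -> embeds X Y -> exists g : Y -> X, forall x, exists y, g y = x.
Proof.
move=> x0 [f fI].
have [|g gP] := choice (P := fun y x => forall x', f x' = y -> x' = x).
  move=> y; have [[x <-]|nx] := pselect (exists x, f x = y).
    by exists x => x' /fI.
  by exists x0 => x' fx'; case: nx; exists x'.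
by exists g => x; exists (f x); rewrite -(gP _ x).
Qed.

(** * Well-orders *)

(* Besides being a well-order, [lt] has the order type of an initial ordinal. *)
Definition initial_order X (lt : X -> X -> Prop) :=
  [/\ well_founded lt, forall x y, [\/ lt x y, x = y | lt y x] &
      forall x, ~ embeds X {y | lt y x}].

Lemma wf_irrefl X (lt : X -> X -> Prop) : well_founded lt -> forall x, ~ lt x x.
Proof. by move=> wf; elim/(well_founded_ind wf) => x IH xx; apply: (IH x). Qed.

Lemma wf_total_trans X (lt : X -> X -> Prop) : well_founded lt ->
  (forall x y, [\/ lt x y, x = y | lt y x]) ->
  forall x y z, lt x y -> lt y z -> lt x z.
Proof.
move=> wf tri.
have no2 : forall x y, lt x y -> ~ lt y x.
  by elim/(well_founded_ind wf) => x IH y xy yx; apply: (IH y yx x).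
have no3 : forall x y z, lt x y -> lt y z -> ~ lt z x.
  by elim/(well_founded_ind wf) => x IH y z xy yz zx; apply: (IH z zx x y).
move=> x y z xy yz; case: (tri x z) => // [xz|zx]; last by case: (no3 x y z).
by case: (no2 _ _ xy); rewrite xz.
Qed.

Lemma wf_min X (lt : X -> X -> Prop) (P : X -> Prop) : well_founded lt ->
  (exists x, P x) -> exists x, P x /\ forall y, lt y x -> ~ P y.
Proof.
move=> wf [x]; elim/(well_founded_ind wf): x => x IH Px.
have [[y [yx Py]]|nP] := pselect (exists y, lt y x /\ P y); first exact: IH yx Py.
by exists x; split=> // y yx Py; apply: nP; exists y.
Qed.

Lemma well_order_exists X : exists lt : X -> X -> Prop,
  well_founded lt /\ forall x y, [\/ lt x y, x = y | lt y x].
Proof.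
elim/Peq: X => X; have [R woR] := well_ordering_principle X.
have minR (P : X -> Prop) x : P x -> exists z, P z /\ forall y, P y -> R z y.
  move=> Px; have [|z [[/asboolP Pz zP] _]] := woR (fun x => `[<P x>]).
    by exists x; apply/asboolP.
  by exists z; split=> // y Py; apply/zP/asboolP.
have antiR x y : R x y -> R y x -> x = y.
  move=> xy yx; have [|z [_ zU]] := woR (pred2 x y); first by exists x; rewrite inE eqxx.
  have xx : R x x by have [z' [-> /(_ x erefl)]] := minR (eq^~ x) x erefl.
  have yy : R y y by have [z' [-> /(_ y erefl)]] := minR (eq^~ y) y erefl.
  have zx : z = x by apply: zU; split=> [|t]; rewrite inE ?eqxx // => /orP[] /eqP ->.
  have zy : z = y.
    by apply: zU; split=> [|t]; rewrite inE ?eqxx ?orbT // => /orP[] /eqP ->.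
  by rewrite -zx -zy.
exists (fun x y => R x y /\ x <> y); split.
- move=> x; apply: contrapT => nx.
  have [z [nz zmin]] := minR (fun x => ~ Acc _ x) x nx; apply: nz; constructor => y [yz nyz].
  by apply: contrapT => ny; apply: nyz; apply: antiR yz (zmin _ ny).
- move=> x y; have [->|xy] := pselect (x = y); first exact: Or32.
  have [z [[] -> zP]] := minR (fun z => z = x \/ z = y) x (or_introl erefl).
  + by apply: Or31; split=> //; apply: zP; right.
  + by apply: Or33; split; [apply: zP; left|move=> /esym].
Qed.

(** In a well-order of [X], take the least point below which there is room for a copy of [X], and
    pull the order back along an injection of [X] into that segment: a segment of the new order with
    room for [X] would contradict minimality. If there is no such point, the order itself is
    initial. *)
Lemma initial_order_exists X : exists lt : X -> X -> Prop, initial_order lt.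
Proof.
have [lt [wf tri]] := well_order_exists X.
have [[x Xx]|nX] := pselect (exists x, embeds X {y | lt y x}); last first.
  by exists lt; split=> // x Xx; apply: nX; exists x.
have [|{Xx}x [[j jI] xmin]] := wf_min (P := fun x => embeds X {y | lt y x}) wf.
  by exists x.
pose r y := sval (j y).
have rI : injective r.
  move=> y z; rewrite /r => E; apply: jI; move: E.
  by case: (j y) (j z) => [a p] [b q] /= ab; apply: eq_exist.
exists (fun y z => lt (r y) (r z)); split.
- move=> y; have [z zy] : exists z, z = r y by eexists.
  elim/(well_founded_ind wf): z y zy => z IH y zy; constructor=> t ty.
  by apply: IH erefl; rewrite zy.
- by move=> y z; case: (tri (r y) (r z)) => [?|/rI|?]; [apply: Or31|apply: Or32|apply: Or33].
- move=> y [f fI]; apply: (xmin (r y)); first exact: (svalP (j y)).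
  exists (fun z => exist _ (r (sval (f z))) (svalP (f z))) => z t [/rI E].
  by apply: fI; move: E; case: (f z) (f t) => [a p] [b q] /= ab; apply: eq_exist.
Qed.

Definition update X V (s : X -> V) (x : X) (v : V) : X -> V :=
  fun y => if `[<y = x>] then v else s y.

Lemma update_same X V (s : X -> V) x v : update s x v x = v.
Proof. by rewrite /update asboolT. Qed.

Lemma update_other X V (s : X -> V) x v y : y <> x -> update s x v y = s y.
Proof. by move=> yx; rewrite /update asboolF. Qed.

(** Transfinite recursion: [P x] depends only on the values up to [x], so later values may be filled
    with [v0]. Choice fixes [nxt], a value that works whenever all earlier constraints hold. *)
Lemma wf_choice X V (v0 : V) (lt : X -> X -> Prop) (P : X -> (X -> V) -> Prop) :
    well_founded lt -> (forall x y z, lt x y -> lt y z -> lt x z) ->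
    (forall x s s', (forall y, lt y x \/ y = x -> s y = s' y) -> P x s -> P x s') ->
    (forall x s, (forall y, lt y x -> P y s) -> exists v, P x (update s x v)) ->
  exists s, forall x, P x s.
Proof.
move=> wf tr loc step.
have /choice[nxt nxtP] (xs : X * (X -> V)) : exists v,
    (forall y, lt y xs.1 -> P y xs.2) -> P xs.1 (update xs.2 xs.1 v).
  case: xs => x s.
  have [/(step x s)[v]|] := pselect (forall y, lt y x -> P y s); first by exists v.
  by exists v0.
pose ext x (rec : forall y, lt y x -> V) : X -> V :=
  fun y => match pselect (lt y x) with left yx => rec y yx | right _ => v0 end.
pose s := Fix wf (fun=> V) (fun x rec => nxt (x, ext x rec)).
pose below x y := match pselect (lt y x) with left _ => s y | right _ => v0 end.
have sE x : s x = nxt (x, below x).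
  rewrite /s Fix_eq // => y f g fg; congr (nxt (_, _)); apply/funext => z.
  by rewrite /ext; case: pselect.
have belowE x y : lt y x -> below x y = s y by rewrite /below; case: pselect.
exists s; elim/(well_founded_ind wf) => x IH.
have := nxtP (x, below x); rewrite -sE /= => {}nxtP.
apply: (loc x (update (below x) x (s x))).
  move=> y; have [->|yx] := pselect (y = x); first by rewrite update_same.
  by rewrite update_other // => -[/belowE|].
apply: nxtP => y yx; apply: loc (IH y yx) => z zy.
by rewrite belowE //; case: zy => [/tr|->//]; apply.
Qed.

(** * Independent functions *)

Section IndependentFamily.
Variables (W L : Type) (w0 : W) (l0 : L).

Definition ifam_index : Type :=
  ((W * W -> L) * (W -> (W * W -> Prop)) * (W -> W))%type.

(* If [e] separates at most [|W|] given sets, then each of them is determined by its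
   trace on [e], and its value can be read off [t] and [h]. *)
Definition ifam (X : L -> Prop) (p : ifam_index) : W :=
  let: (e, t, h) := p in
  match pselect (exists w, t w = X \o e) with
  | left ex => h (sval (cid ex)) | right _ => w0 end.

(** The point [e (w, w')] separates [k w] from [k w'] if they differ; so equal traces on [e] mean
    equal sets, and the trace determines [v (k w)]. *)
Lemma ifam_independent (k : W -> (L -> Prop)) (v : (L -> Prop) -> W) :
  exists p, forall w, ifam (k w) p = v (k w).
Proof.
have [|e eP] := choice (P := fun p l => k p.1 <> k p.2 -> k p.1 l <> k p.2 l).
  move=> [w w'] /=; have [E|] := pselect (k w = k w'); first by exists l0.
  move=> nE; have [l nl] : exists l, k w l <> k w' l.
    by apply/existsNP => E; apply/nE/funext.
  by exists l.
exists (e, fun w => k w \o e, fun w => v (k w)) => w.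
rewrite /ifam; case: pselect => [ex|[]]; last by exists w.
case: cid => w' /= E; congr v; apply: contrapT => /(eP (w', w)) /=; apply.
by have /(congr1 (@^~ (w', w))) := E.
Qed.

End IndependentFamily.

(** * A fresh function agreeing with given selectors *)

Section FreshFunction.
Variables (W I T : Type) (F : T -> I -> W) (w0 : W) (t0 : T).

(** Since [v] depends on the index in [T] and not on [w], a repetition in [k] causes no conflict. *)
Definition fulfills (k : W -> T) (v : T -> W) (i : I) := forall w, F (k w) i = v (k w).

Definition avoids (k : W -> T) (rm : T -> Prop) := forall w, ~ rm (k w).

(** [E c] will be a set of the filter, [g c] selects a witness at each of its points, and [rm]
    contains the functions already used. *)
Variables (C : Type) (E : C -> I -> Prop) (g : C -> I -> W) (rm : T -> Prop).
Hypothesis W2 : embeds (W * option W) W.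
Hypothesis consE : forall c k v, avoids k rm -> exists i, E c i /\ fulfills k v i.

(* [None] gives a function [f], and [Some w] a condition avoiding it
   which forces [f] to differ from [g c] on [E c]. *)
Definition bad (b : (option W -> T) * (T -> W) * C) :=
  let: (k, v, c) := b in
  [/\ forall o, ~ rm (k o), forall w, k (Some w) <> k None &
      forall i, E c i -> fulfills (k \o Some) v i -> F (k None) i <> g c i].

(** Otherwise [W] many bad triples share [c]. Different triples have no function in common, so a
    single prescription [v] fulfills all their conditions and gives each [K w None] the value [w].
    At a point [i] of [E c] meeting it, the triple with index [g c i] is contradicted: its function
    takes the value [g c i] there. *)
Lemma bad_fiber (M : set ((option W -> T) * (T -> W) * C)) c :
    (forall b, M b -> bad b) ->
    (forall b b' o o', M b -> M b' -> b.1.1 o = b'.1.1 o' -> b = b') ->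
  embeds {b | M b /\ b.2 = c} W.
Proof.
move=> Mbad Mdisj; have [//|[j jI]] := embeds_total {b | M b /\ b.2 = c} W.
exfalso; have [sur surP] := embeds_surj (w0, None) W2.
pose K w := (sval (j w)).1.1; pose V w := (sval (j w)).1.2.
have jM w : M (sval (j w)) by have [] := svalP (j w).
have KI w w' o o' : K w o = K w' o' -> w = w'.
  move=> /(Mdisj _ _ _ _ (jM w) (jM w')) E'; apply: jI.
  by case: (j w) (j w') E' => [? ?] [? ?] /= E'; apply: eq_exist.
have badj w : [/\ forall o, ~ rm (K w o), forall u, K w (Some u) <> K w None &
    forall i, E c i -> fulfills (K w \o Some) (V w) i -> F (K w None) i <> g c i].
  have [_ jc] := svalP (j w); have := Mbad _ (jM w); move: jc; rewrite /K /V.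
  by case: (sval (j w)) => [[k v] c'] /= ->.
have [|v vP] := choice (P := fun t u => (forall w, K w None = t -> u = w) /\
    (forall w w', K w (Some w') = t -> u = V w t)).
  move=> t; have [[w Kw]|n1] := pselect (exists w, K w None = t).
    exists w; split=> [w'|w' w'']; rewrite -Kw => E'; first by rewrite (KI _ _ _ _ E').
    by have ww := KI _ _ _ _ E'; case: (badj w) => _ + _ => /(_ w'') []; rewrite -E' ww.
  have [[w [w' Kw]]|n2] := pselect (exists w w', K w (Some w') = t).
    exists (V w t); split=> [w''|w'' w''']; rewrite -Kw => E'.
      by case: n1; exists w''; rewrite E'.
    by rewrite (KI _ _ _ _ E').
  exists w0; split=> [w|w w'] Kw; first by case: n1; exists w.
  by case: n2; exists w, w'.
have [|i [Ei mi]] := @consE c (fun u => K (sur u).1 (sur u).2) v.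
  by move=> u; case: (badj (sur u).1).
have {mi} mi w o : F (K w o) i = v (K w o).
  by have [u su] := surP (w, o); have := mi u; rewrite su.
have [_ _ /(_ i Ei)] := badj (g c i); apply.
- by move=> w; rewrite mi; have [_ /(_ _ _ erefl)] := vP (K (g c i) (Some w)).
- by rewrite mi; have [/(_ _ erefl)] := vP (K (g c i) None).
Qed.

(** Take a maximal family [M] of bad triples with pairwise disjoint functions. By [bad_fiber] they
    involve few functions, so some [f] lies outside them and outside [rm]; let [rm'] consist of [f]
    and the functions of [M]. A prescription avoiding [rm] and [rm'] under which [f] cannot match
    [g c] on [E c] would give a further bad triple disjoint from [M]. *)
Lemma fresh_function :
    (forall h : C * W * option W -> T, exists f, ~ rm f /\ forall z, h z <> f) ->
  exists f (rm' : T -> Prop), [/\ rm' f,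
    exists h : option (C * W * option W) -> T, forall t, rm' t -> exists z, h z = t &
    forall c k v, avoids k (fun t => rm t \/ rm' t) ->
      exists i, [/\ E c i, fulfills k v i & F f i = g c i]].
Proof.
move=> fr.
pose P (M : set ((option W -> T) * (T -> W) * C)) := (forall b, M b -> bad b) /\
  (forall b b' o o', M b -> M b' -> b.1.1 o = b'.1.1 o' -> b = b').
have [|M [[Mbad Mdisj] Mmax]] := @Zorn_bigcup _ P.
  move=> G GP Gtot; split=> [b [U GU Ub]|b b' o o' [U GU Ub] [V GV Vb']].
    by have [+ _] := GP _ GU; apply.
  have [UV|VU] := Gtot _ _ GU GV.
  - by have [_ +] := GP _ GV; apply => //; apply: UV.
  - by have [_ +] := GP _ GU; apply => //; apply: VU.
have /choice[e eP] c : exists e : _ -> W, forall b b', M b -> M b' -> b.2 = c ->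
    b'.2 = c -> e b = e b' -> b = b'.
  have [e eI] := bad_fiber c Mbad Mdisj.
  exists (fun b => match pselect (M b /\ b.2 = c) with
    | left Mb => e (exist _ b Mb) | right _ => w0 end) => b b' Mb Mb' bc b'c.
  case: pselect => [p|[]//]; case: pselect => [p'|[]//].
  by move/eI => [].
(* [h] recovers a triple of [M] from its component [c] and its code [w] among the triples with this
   [c], and returns its function at [o]. *)
have [|h hP] := choice (P := fun (z : C * W * option W) t =>
    forall b, M b -> b.2 = z.1.1 -> e b.2 b = z.1.2 -> t = b.1.1 z.2).
  move=> [[c w] o] /=.
  have [[b [Mb bc ew]]|nb] := pselect (exists b, [/\ M b, b.2 = c & e b.2 b = w]).
    exists (b.1.1 o) => b' Mb' b'c ew'; rewrite (eP c b b') //.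
    by move: ew ew'; rewrite bc b'c => -> ->.
  by exists t0 => b Mb bc ew; case: nb; exists b.
have [f [rmf hf]] := fr h.
have Mf b o : M b -> b.1.1 o <> f.
  by move=> Mb bf; apply: (hf (b.2, e b.2 b, o)); rewrite -bf; apply: hP.
exists f, (fun t => t = f \/ exists b o, M b /\ b.1.1 o = t); split; first by left.
- exists (fun z => if z is Some z then h z else f) => t [->|[b [o [Mb <-]]]].
    by exists None.
  by exists (Some (b.2, e b.2 b, o)); apply: hP.
move=> c k v kav; apply: contrapT => ni.
pose b0 : (option W -> T) * (T -> W) * C := (fun o => if o is Some w then k w else f, v, c).
apply: (Mmax (fun b => M b \/ b = b0)).
  split=> [b Mb|]; first by left.
  by move=> /(_ _ (or_intror erefl)) /Mf -/(_ None).
split=> [b [/Mbad//|->]|].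
  split=> [[w|]|w kf|i Ei mi fg] //=.
  - by move=> rmk; apply: (kav w); left.
  - by apply: (kav w); right; left.
  - by apply: ni; exists i.
have disj b o o' : M b -> b.1.1 o <> b0.1.1 o'.
  case: o' => [w|] Mb /=; last exact: Mf.
  by move=> E'; apply: (kav w); right; right; exists b, o.
move=> b b' o o' [Mb|->] [Mb'|->] //; first exact: Mdisj.
- by move=> /(disj _ _ _ Mb).
- by move=> /esym /(disj _ _ _ Mb').
Qed.

End FreshFunction.

(** * Formulas and ultrapowers *)

Section Formulas.
Variables (tau : signature) (D : Type) (s : D -> nat).
Implicit Types (S : nat -> Prop) (t : term tau) (phi : formula tau s).

Lemma term_vars_in_mono S S' t :
  (forall n, S n -> S' n) -> term_vars_in S t -> term_vars_in S' t.
Proof.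
by move=> SS'; elim: t => [n|f a IH] /=; [apply: SS'|move=> Sa k; apply: IH].
Qed.

Lemma fvars_in_mono S S' phi :
  (forall n, S n -> S' n) -> fvars_in S phi -> fvars_in S' phi.
Proof.
elim: phi S S' => [t u|r a|i a|p IH|p IHp q IHq|x p IH] S S' SS' /=.
- by case=> St Su; split; apply: term_vars_in_mono SS' _.
- by move=> Sa k; apply: term_vars_in_mono SS' _.
- by move=> Sa k; apply: term_vars_in_mono SS' _.
- exact: IH.
- by case=> Sp Sq; split; [apply: IHp Sp|apply: IHq Sq].
- by apply: IH => k [->|/SS'?]; [left|right].
Qed.

Lemma eval_term_ext (A : structure tau) S t (r r' : nat -> A) :
  term_vars_in S t -> (forall n, S n -> r n = r' n) -> eval_term r t = eval_term r' t.
Proof.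
move=> St rr'; elim: t St => [n|f a IH] /= St; first exact: rr'.
by congr fn; apply/funext => k; apply: IH.
Qed.

Lemma sat_ext (A : structure tau) (R : rel_tuple s A) S phi (r r' : nat -> A) :
  fvars_in S phi -> (forall n, S n -> r n = r' n) -> sat R r phi <-> sat R r' phi.
Proof.
have args n (a : 'I_n -> term tau) T (q q' : nat -> A) :
    (forall k, term_vars_in T (a k)) -> (forall n, T n -> q n = q' n) ->
    (fun k => eval_term q (a k)) = (fun k => eval_term q' (a k)).
  by move=> Ta qq'; apply/funext => k; apply: eval_term_ext (Ta k) qq'.
elim: phi S r r' => [t u|P a|i a|p IH|p IHp q IHq|x p IH] S r r' /= + rr'.
- by case=> /eval_term_ext/(_ rr') -> /eval_term_ext/(_ rr') ->.
- by move=> Sa; rewrite (args _ _ _ _ _ Sa rr').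
- by move=> Sa; rewrite (args _ _ _ _ _ Sa rr').
- by move=> /IH/(_ rr') ->.
- by case=> /IHp/(_ rr') -> /IHq/(_ rr') ->.
- move=> Sp; have E b := IH _ (fun k => if k == x then b else r k)
    (fun k => if k == x then b else r' k) Sp.
  by split=> -[b Pb]; exists b; move: Pb; apply E => k; case: eqP => // ? [|/rr'].
Qed.

Lemma term_vars_bounded t : exists N, term_vars_in (fun n => n < N) t.
Proof.
elim: t => [n|f a /choice[N aN]] /=; first by exists n.+1.
exists (\max_k N k) => k; apply: term_vars_in_mono (aN k) => n nN.
exact: leq_trans nN (leq_bigmax k).
Qed.

Lemma terms_vars_bounded n (a : 'I_n -> term tau) :
  exists N, forall k, term_vars_in (fun n => n < N) (a k).
Proof.
have /choice[N aN] := fun k => term_vars_bounded (a k).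
exists (\max_k N k) => k; apply: term_vars_in_mono (aN k) => m mN.
exact: leq_trans mN (leq_bigmax k).
Qed.

Lemma fvars_bounded phi : exists N, fvars_in (fun n => n < N) phi.
Proof.
have lt_maxn M N n : (n < M -> n < maxn M N) * (n < N -> n < maxn M N).
  by split=> H; rewrite leq_max H ?orbT.
elim: phi => [t u|P a|i a|p [N pN]|p [M pM] q [N qN]|x p [N pN]] /=.
- have [[M tM] [N uN]] := (term_vars_bounded t, term_vars_bounded u).
  exists (maxn M N); split; [apply: term_vars_in_mono tM|apply: term_vars_in_mono uN];
    by move=> n; apply lt_maxn.
- exact: terms_vars_bounded.
- exact: terms_vars_bounded.
- by exists N.
- exists (maxn M N); split; [apply: fvars_in_mono pM|apply: fvars_in_mono qN];
    by move=> n; apply lt_maxn.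
- by exists N; apply: fvars_in_mono pN => n; right.
Qed.

(** * Renaming of variables *)

Fixpoint rename_term (j : nat -> nat) t : term tau :=
  match t with
  | Var n => Var tau (j n)
  | App f a => App (fun k => rename_term j (a k))
  end.

Lemma rename_term_vars j S t :
  term_vars_in (fun n => S (j n)) t -> term_vars_in S (rename_term j t).
Proof. by elim: t => [n|f a IH] //= Sa k; apply: IH. Qed.

Lemma eval_rename_term (A : structure tau) j (r : nat -> A) t :
  eval_term r (rename_term j t) = eval_term (fun n => r (j n)) t.
Proof. by elim: t => [n|f a IH] //=; congr fn; apply/funext => k; rewrite IH. Qed.

(* [j] may identify variables, so bound variables are replaced by fresh ones. *)
Lemma rename_formula j phi : exists phi' : formula tau s,
  (forall S, fvars_in (fun n => S (j n)) phi -> fvars_in S phi') /\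
  forall (A : structure tau) (R : rel_tuple s A) r,
    sat R r phi' <-> sat R (fun n => r (j n)) phi.
Proof.
elim: phi j => [t u|P a|i a|p IH|p IHp q IHq|x p IH] j.
- exists (FEq s (rename_term j t) (rename_term j u)); split=> [S [] |A R r] /=.
    by split; apply: rename_term_vars.
  by rewrite !eval_rename_term.
- exists (FRel s (fun k => rename_term j (a k))); split=> [S Sa k|A R r] /=.
    exact: rename_term_vars.
  by under eq_fun do rewrite eval_rename_term.
- exists (FX (fun k => rename_term j (a k))); split=> [S Sa k|A R r] /=.
    exact: rename_term_vars.
  by under eq_fun do rewrite eval_rename_term.
- have [p' [vp' sp']] := IH j; exists (FNeg p'); split=> [S /vp'|A R r] //=.
  by rewrite sp'.
- have [[p' [vp' sp']] [q' [vq' sq']]] := (IHp j, IHq j).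
  exists (FAnd p' q'); split=> [S [/vp' ? /vq' ?]|A R r] //=.
  by rewrite sp' sq'.
have [N pN] := fvars_bounded p.
(* [z] exceeds the image under [j] of every free variable of [p], so binding it captures nothing. *)
pose z := (\max_(v < N) j v).+1; pose j' (v : nat) := if v == x then z else j v.
have jz v : v < N -> (j v == z) = false.
  by move=> vN; rewrite ltn_eqF // ltnS (leq_bigmax (Ordinal vN)).
have [p' [vp' sp']] := IH j'; exists (FEx z p'); split=> [S Sp|A R r] /=.
  by apply: vp'; move: Sp => /=; apply: fvars_in_mono => n; rewrite /j';
    case: eqP => [|_ [//|]]; [left|right].
have E b : sat R (fun k => if k == z then b else r k) p' <->
    sat R (fun k => if k == x then b else r (j k)) p.
  rewrite sp'; apply: sat_ext pN _ => v vN; rewrite /j'.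
  by case: (v == x); rewrite ?eqxx ?jz.
by split=> -[b /E]; exists b.
Qed.

(** * Agreement of two structures on finitely many formulas *)

Section Agreement.
Variables (A : structure tau) (R : rel_tuple s A) (B : structure tau) (Q : rel_tuple s B).

Definition agree (Psi : seq (formula tau s)) (n : nat) (a : nat -> A) (b : nat -> B) :=
  forall phi, List.In phi Psi -> fvars_in (fun k => k < n) phi ->
    sat R a phi <-> sat Q b phi.

Lemma agree_cat Psi Psi' n a b : agree (Psi ++ Psi') n a b ->
  agree Psi n a b /\ agree Psi' n a b.
Proof.
by move=> ag; split=> phi In_phi; apply: ag; apply/List.in_or_app; [left|right].
Qed.

End Agreement.

Lemma agree_sym (A : structure tau) (R : rel_tuple s A) (B : structure tau)
    (Q : rel_tuple s B) Psi n a b : agree R Q Psi n a b -> agree Q R Psi n b a.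
Proof. by move=> ag phi /ag phiP /phiP ->. Qed.

(** [theta] collects the relevant formulas of [Psi], each with the sign it has at [x]; at the end of
    the list [FEx n theta] provides [y]. As [Psi'] must not depend on [x], it includes the lists
    arising from both signs. *)
Lemma agree_extend_sat n Psi theta : fvars_in (fun k => k < n.+1) theta ->
  exists Psi', forall (A : structure tau) (R : rel_tuple s A) (B : structure tau)
      (Q : rel_tuple s B) a b, agree R Q Psi' n a b ->
    forall x, sat R (fun k => if k == n then x else a k) theta ->
    exists y, sat Q (fun k => if k == n then y else b k) theta /\
      agree R Q Psi n.+1 (fun k => if k == n then x else a k)
        (fun k => if k == n then y else b k).
Proof.
elim: Psi theta => [|phi Psi IH] theta vtheta.
  exists [:: FEx n theta] => A R B Q a b ag x sx.
  have vEx : fvars_in (fun k => k < n) (FEx n theta).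
    move: vtheta => /=; apply: fvars_in_mono => k.
    by rewrite ltnS leq_eqVlt => /orP[/eqP ->|kn]; [left|right].
  have /= [+ _] := ag (FEx n theta) (or_introl erefl) vEx.
  move=> /(_ (ex_intro _ x sx))[y sy].
  by exists y; split.
have [vphi|nphi] := pselect (fvars_in (fun k => k < n.+1) phi); last first.
  have [Psi' PsiP] := IH theta vtheta; exists Psi' => A R B Q a b ag x sx.
  have [y [sy agy]] := PsiP A R B Q a b ag x sx; exists y; split=> //.
  by move=> psi [<- /nphi //|]; apply: agy.
have [Psi1 Psi1P] := IH (FAnd theta phi) (conj vtheta vphi).
have [Psi2 Psi2P] := IH (FAnd theta (FNeg phi)) (conj vtheta vphi).
exists (Psi1 ++ Psi2) => A R B Q a b /agree_cat[ag1 ag2] x sx.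
have [px|npx] := pselect (sat R (fun k => if k == n then x else a k) phi).
- have [y [[sy py] agy]] := Psi1P A R B Q a b ag1 x (conj sx px).
  by exists y; split=> // psi [<-|]; [split|apply: agy].
- have [y [[sy npy] agy]] := Psi2P A R B Q a b ag2 x (conj sx npx).
  by exists y; split=> // psi [<-|]; [split|apply: agy].
Qed.

Lemma agree_extend n Psi : exists Psi', forall (A : structure tau) (R : rel_tuple s A)
    (B : structure tau) (Q : rel_tuple s B) a b, agree R Q Psi' n a b ->
  forall x, exists y, agree R Q Psi n.+1 (fun k => if k == n then x else a k)
    (fun k => if k == n then y else b k).
Proof.
have [Psi' PsiP] := @agree_extend_sat n Psi (FEq s (Var tau 0) (Var tau 0)) (conj isT isT).
exists Psi' => A R B Q a b ag x.
by have [//|y [_ agy]] := PsiP A R B Q a b ag x; exists y.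
Qed.

Section Assignments.
Variable T : Type.

Definition assign X (d : X) (f : T -> X) (l : seq T) (n : nat) : X := nth d (map f l) n.

Lemma In_assign (l : seq T) x : List.In x l ->
  exists m, m < size l /\ forall X (d : X) f, assign d f l m = f x.
Proof.
elim: l => [//|y l IH] [->|/IH[m [ml mP]]]; first by exists 0.
by exists m.+1.
Qed.

Lemma assign_In (l : seq T) n : n < size l ->
  exists x, List.In x l /\ forall X (d : X) f, assign d f l n = f x.
Proof.
elim: l n => [//|y l IH] [|n] /=; first by exists y; split; [left|].
by move/IH => [x [xl xP]]; exists x; split; [right|].
Qed.

(** Positions in [l] are sent to positions of the same entries in [l'], and [Psi] is renamed along
    this map, which need not be injective. *)
Lemma agree_weaken (l l' : seq T) Psi : (forall x, List.In x l -> List.In x l') ->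
  exists Psi', forall (A : structure tau) (R : rel_tuple s A) (B : structure tau)
      (Q : rel_tuple s B) a b d e,
    agree R Q Psi' (size l') (assign d a l') (assign e b l') ->
    agree R Q Psi (size l) (assign d a l) (assign e b l).
Proof.
move=> ll'; have /choice[j jP] n : exists m, n < size l -> m < size l' /\
    forall X (d : X) f, assign d f l' m = assign d f l n.
  have [/assign_In[x [/ll'/In_assign[m [ml' mP]] xP]]|] := boolP (n < size l).
    by exists m => _; split=> // X d f; rewrite mP xP.
  by exists 0.
have /choice[ren renP] := rename_formula j.
exists (map ren Psi) => A R B Q a b d e ag phi phi_Psi vphi.
have [vren sren] := renP phi.
have lift (C : structure tau) (P : rel_tuple s C) c (f : T -> C) :
    sat P (assign c f l') (ren phi) <-> sat P (assign c f l) phi.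
  rewrite sren; apply: sat_ext vphi _ => n nl.
  by have [_ ->] := jP n nl.
rewrite -!lift; apply: ag; first exact: List.in_map.
by apply: vren; apply: fvars_in_mono vphi => n /jP[].
Qed.

End Assignments.

(** * Transfer of sentences along an isomorphism of ultrapowers *)

Section IsoTransfer.
Variables (A : structure tau) (R : rel_tuple s A) (I : Type) (U : (I -> Prop) -> Prop).
Variables (B : structure tau) (Q : rel_tuple s B) (J : Type) (V : (J -> Prop) -> Prop).
Hypotheses (uU : ultrafilter U) (uV : ultrafilter V).

Lemma ultra_all (K : Type) (M : (K -> Prop) -> Prop) n (P : 'I_n -> K -> Prop) :
  ultrafilter M -> (forall k, M (P k)) -> M (fun i => forall k, P k i).
Proof.
move=> [MT [_ [Mmono [Mand _]]]] MP.
have : M (fun i => forall k, k \in enum 'I_n -> P k i).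
  elim: (enum 'I_n) => [|k e IH]; first by apply: Mmono MT _.
  apply: Mmono (Mand _ _ (MP k) IH) _ => i [Pk Pe] k'.
  by rewrite inE => /orP[/eqP ->|/Pe].
by move/Mmono; apply => i Pi k; apply: Pi; rewrite mem_enum.
Qed.

(** An induction as in Łoś's theorem, run through [h], compares truth on [U]-large sets with truth
    on [V]-large sets; a sentence holds at all indices or at none. *)
Lemma iso_ultrapowers_models phi : iso_ultrapowers R U Q V -> sentence phi ->
  models R phi <-> models Q phi.
Proof.
move=> [h [heq [hsurj [hfn [hrl hX]]]]].
have [UT [U0 [Umono [Uand Uor]]]] := uU; have [VT [V0 [Vmono [Vand Vor]]]] := uV.
have hterm t (r : nat -> I -> A) : V (fun j =>
    h (fun i => eval_term (fun n => r n i) t) j = eval_term (fun n => h (r n) j) t).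
  elim: t => [n|f a IH] /=; first exact: Vmono VT _.
  apply: Vmono (Vand _ _ (hfn f (fun k i => eval_term (fun n => r n i) (a k)))
    (ultra_all uV IH)) _ => j [-> E].
  by congr fn; apply/funext.
have Vargs n (a : 'I_n -> term tau) (r : nat -> I -> A) : V (fun j =>
    (fun k => h (fun i => eval_term (fun m => r m i) (a k)) j) =
    (fun k => eval_term (fun m => h (r m) j) (a k))).
  apply: Vmono (ultra_all uV (fun k => hterm (a k) r)) _ => j E.
  exact/funext.
have Vrw X Y : V (fun j => X j <-> Y j) -> V X <-> V Y.
  by move=> XY; split=> H; apply: Vmono (Vand _ _ XY H) _ => j [E ?]; apply/E.
have hsat : forall (r : nat -> I -> A), U (fun i => sat R (fun n => r n i) phi) <->
    V (fun j => sat Q (fun n => h (r n) j) phi).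
  elim: phi => [t u|P a|i0 a|p IH|p IHp q IHq|x p IH] r /=.
  - rewrite heq; apply: Vrw; apply: Vmono (Vand _ _ (hterm t r) (hterm u r)) _.
    by move=> j [-> ->].
  - rewrite (hrl P (fun k i => _)); apply: Vrw; apply: Vmono (Vargs _ a r) _.
    by move=> j ->.
  - rewrite (hX i0 (fun k i => _)); apply: Vrw; apply: Vmono (Vargs _ a r) _.
    by move=> j ->.
  - split=> H.
    + have [/IH Up|//] := Vor (fun j => sat Q (fun n => h (r n) j) p).
      by case: U0; apply: Umono (Uand _ _ H Up) _ => i [].
    + have [/IH Vp|//] := Uor (fun i => sat R (fun n => r n i) p).
      by case: V0; apply: Vmono (Vand _ _ H Vp) _ => i [].
  - split=> H.
    + by apply: Vand; [apply/IHp|apply/IHq]; apply: Umono H _ => i [].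
    + by apply: Uand; [apply/IHp|apply/IHq]; apply: Vmono H _ => i [].
  - have ifU (b : I -> A) i : (fun n => (if n == x then b else r n) i) =
        (fun n => if n == x then b i else r n i).
      by apply/funext => n; case: ifP.
    have ifV (b : I -> A) j : (fun n => h (if n == x then b else r n) j) =
        (fun n => if n == x then h b j else h (r n) j).
      by apply/funext => n; case: ifP.
    split=> H.
    + have /choice[b bP] i : exists b,
          (exists b, sat R (fun k => if k == x then b else r k i) p) ->
          sat R (fun k => if k == x then b else r k i) p.
        by have [[b]|nb] := pselect (exists b, sat R (fun k => if k == x then b else r k i) p);
          [exists b|exists (inhab A)].
      have /IH : U (fun i => sat R (fun n => (if n == x then b else r n) i) p).
        by apply: Umono H _ => i /bP; rewrite ifU.
      by move/Vmono; apply=> j; rewrite ifV; exists (h b j).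
    (* Pointwise witnesses form a function [J -> B], which equals some [h b] on a [V]-large set. *)
    + have /choice[y yP] j : exists y,
          (exists y, sat Q (fun k => if k == x then y else h (r k) j) p) ->
          sat Q (fun k => if k == x then y else h (r k) j) p.
        by have [[y]|ny] := pselect (exists y, sat Q (fun k => if k == x then y else h (r k) j) p);
          [exists y|exists (inhab B)].
      have [b hb] := hsurj y.
      have /IH : V (fun j => sat Q (fun n => h (if n == x then b else r n) j) p).
        by apply: Vmono (Vand _ _ H hb) _ => j [/yP]; rewrite ifV => + ->.
      by move/Umono; apply=> i; rewrite ifU; exists (b i).
move=> sphi; have E (C : structure tau) (P : rel_tuple s C) q :
  sat P q phi <-> models P phi by apply: sat_ext sphi _.
split=> H.
- have /hsat : U (fun i => sat R (fun n => inhab A) phi) by apply: Umono UT _.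
  have [VX _|VX VY] := Vor (fun=> models Q phi).
    by apply: contrapT => nQ; apply: V0; apply: Vmono VX _.
  by case: V0; apply: Vmono (Vand _ _ VX VY) _ => j [+ /E].
- have /hsat : V (fun j => sat Q (fun n => h (fun=> inhab A) j) phi).
    by apply: Vmono VT _ => j _; apply/E.
  have [UX _|UX UY] := Uor (fun=> models R phi).
    by apply: contrapT => nR; apply: U0; apply: Umono UX _.
  by case: U0; apply: Umono (Uand _ _ UX UY) _ => i [+ /E].
Qed.

End IsoTransfer.
End Formulas.

(** * The Keisler-Shelah theorem *)

Section Construction.
Variables (tau : signature) (D : Type) (s : D -> nat).
Variables (A : structure tau) (R : rel_tuple s A) (B : structure tau) (Q : rel_tuple s B).
Hypothesis AB : forall phi, sentence phi -> models R phi <-> models Q phi.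
Variables (W I T : Type) (F : T -> I -> W) (w0 : W) (t0 : T).
Hypotheses (Winf : embeds nat W) (WA : embeds A W) (WB : embeds B W).
Hypothesis (Wfm : embeds (formula tau s) W).
Hypothesis (Find : forall k v, exists i, fulfills F k v i).
Variable lt : T -> T -> Prop.
Hypotheses (ini : initial_order lt) (TW : ~ embeds T W).
(** [T] indexes the functions and, ordered by [lt], also the stages; stage [x] has to pair off the
    element [task x] of one of the two powers. *)
Variable task : T -> (I -> A) + (I -> B).

Let le y x := lt y x \/ y = x.

Let lt_wf : well_founded lt. Proof. by case: ini. Qed.
Let lt_total x y : [\/ lt x y, x = y | lt y x]. Proof. by case: ini. Qed.
Let lt_trans x y z : lt x y -> lt y z -> lt x z.
Proof. exact: (wf_total_trans lt_wf lt_total). Qed.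

Lemma stage_max y l : exists m, List.In m (y :: l) /\ forall z, List.In z (y :: l) -> le z m.
Proof.
elim: l y => [|z l IH] y; first by exists y; split; [left|move=> z [->|//]; right].
have [m [zlm mP]] := IH z; case: (lt_total m y) => [my|my|ym].
- exists y; split; first by left.
  move=> t [->|/mP[tm|->]]; [by right|by left; apply: lt_trans tm my|by left].
- exists y; split; first by left.
  by move=> t [->|/mP]; [right|rewrite my].
- exists m; split; first by right.
  by move=> t [<-|/mP]; [left|].
Qed.

Definition stage_size x : Type := ({y | lt y x} + W)%type.

Lemma stage_size_inf x : embeds nat (stage_size x).
Proof. exact/(embeds_trans Winf)/embeds_inr. Qed.

(** The sum is no larger than the larger of [W] and the segment below [x], and [T] embeds in
    neither. *)
Lemma not_embeds_stage x : ~ embeds T (stage_size x).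
Proof.
case: ini => _ _ /(_ x) nx TK.
have [sW|Ws] := embeds_total {y | lt y x} W.
- by apply: TW; apply: embeds_trans TK (embeds_sum_inf Winf sW (embeds_refl W)).
- apply: nx; apply: embeds_trans TK _.
  exact: (embeds_sum_inf (embeds_trans Winf Ws) (embeds_refl _) Ws).
Qed.

Definition covered (P : T -> Prop) (K : Type) :=
  exists h : K -> T, forall t, P t -> exists z, h z = t.

Lemma covered_embeds P K K' : K -> embeds K K' -> covered P K -> covered P K'.
Proof.
move=> z0 /(embeds_surj z0)[g gP] [h hP]; exists (h \o g) => t /hP[z <-].
by have [z' <-] := gP z; exists z'.
Qed.

(** The functions removed up to [x] and those listed by [h] are all decoded by [dec] from at most
    [stage_size x] many codes, too few for [T]. In a code, [None] stands for the stage [x]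
    itself. *)
Lemma uncovered x (rms : T -> T -> Prop) C (h : C -> T) :
    (forall y, le y x -> covered (rms y) (stage_size y)) ->
    embeds C (stage_size x) ->
  exists f, (forall y, le y x -> ~ rms y f) /\ forall z, h z <> f.
Proof.
move=> rmsP CK; apply: contrapT => nf.
have /choice[H HP] y : exists h : stage_size x -> T,
    le y x -> forall t, rms y t -> exists z, h z = t.
  have [yx|nyx] := pselect (le y x); last by exists (fun=> t0).
  have [h' h'P] : covered (rms y) (stage_size x); last by exists h'.
  apply: covered_embeds (rmsP y yx); first exact: (inr w0).
  apply: embeds_sum (embeds_refl W); apply: embeds_sub => z zy.
  by case: yx zy => [yx|->//] /lt_trans; apply.
pose dec (c : option {y | lt y x} * stage_size x + C) := match c with
  | inl p => H (if p.1 is Some y then sval y else x) p.2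
  | inr z => h z end.
have /choice[e eK] t : exists c, dec c = t.
  apply: contrapT => nt; apply: nf; exists t; split=> [y yx rt|z zt].
    have [z zt] := HP y yx t rt; apply: nt; case: yx zt => [yx|->] zt.
      by exists (inl (Some (exist _ y yx), z)).
    by exists (inl (None, z)).
  by apply: nt; exists (inr z).
apply: (@not_embeds_stage x); have Kinf := stage_size_inf x.
apply: embeds_trans (embeds_sum_inf Kinf (embeds_prod_inf Kinf
  (embeds_option_inf Kinf (embeds_inl _ _)) (embeds_refl _)) CK).
by exists e; apply: can_inj eK.
Qed.

(** The two paired elements and the set of functions spent on them. *)
Definition stage : Type := ((I -> A) * (I -> B) * (T -> Prop))%type.

Implicit Types (st : T -> stage) (Psi : seq (formula tau s)) (l : seq T).

Definition asgA st i l := assign (inhab A) (fun y => (st y).1.1 i) l.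
Definition asgB st i l := assign (inhab B) (fun y => (st y).1.2 i) l.

Definition agreement st Psi l i := agree R Q Psi (size l) (asgA st i l) (asgB st i l).

(** More than nonemptiness of the agreement set: the functions not spent at the stages in [P] stay
    independent on it. *)
Definition consistent st P Psi l := forall k v,
  avoids k (fun t => exists y, P y /\ (st y).2 t) ->
  exists i, agreement st Psi l i /\ fulfills F k v i.

Definition invariant x st := [/\
  match task x with inl a => (st x).1.1 = a | inr b => (st x).1.2 = b end,
  covered (st x).2 (stage_size x) &
  forall Psi l, (forall y, List.In y l -> le y x) -> consistent st (le^~ x) Psi l].

Lemma agreement_local st st' Psi l i : (forall y, List.In y l -> st y = st' y) ->
  agreement st Psi l i -> agreement st' Psi l i.
Proof.
move=> stst'; rewrite /agreement /asgA /asgB /assign.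
have E X (f : stage -> X) : map (fun y => f (st y)) l = map (fun y => f (st' y)) l.
  by elim: l stst' => //= y l IH stst'; rewrite stst' ?IH;
    [|move=> z zl; apply: stst'; right|left].
by rewrite (E _ (fun v => v.1.1 i)) (E _ (fun v => v.1.2 i)).
Qed.

Lemma invariant_local x st st' : (forall y, le y x -> st y = st' y) ->
  invariant x st -> invariant x st'.
Proof.
move=> stst' [tx cx consx]; rewrite /invariant -stst'; last by right.
split=> // Psi l lx k v kav; have [|i [agi fi]] := consx Psi l lx k v.
  by move=> w [y [yx]]; rewrite stst' // => ky; apply: (kav w); exists y.
by exists i; split=> //; apply: agreement_local agi => y /lx/stst'.
Qed.

(** A nonempty list has a last stage, whose invariant suffices since the functions spent up to it
    are among those spent before [x]. For the empty list only sentences matter, and [AB] settles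
    them. *)
Lemma consistent_below x st : (forall y, lt y x -> invariant y st) ->
  forall Psi l, (forall y, List.In y l -> lt y x) -> consistent st (lt^~ x) Psi l.
Proof.
move=> inv Psi [|y l] lx k v kav.
  have [i fi] := Find k v; exists i; split=> // phi _ vphi.
  have sphi : sentence phi by apply: fvars_in_mono vphi.
  have E (M : structure tau) (P : rel_tuple s M) r : sat P r phi <-> models P phi.
    exact: sat_ext sphi _.
  by rewrite !E; apply: AB.
have [m [yl_m mP]] := stage_max y l; have mx := lx m yl_m.
have [_ _ cons] := inv m mx; apply: (cons _ _ mP) => w [z [zm rz]].
by apply: (kav w); exists z; split=> //; case: zm => [/lt_trans|->//]; apply.
Qed.

(** With [x] put last, the new pair interprets the last variable, and the other entries form a list
    over the segment below [x], of which there are few. *)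
Lemma below_list x l : (forall y, List.In y l -> le y x) ->
  exists l' : seq {y | lt y x}, forall y, List.In y l -> List.In y (rcons (map sval l') x).
Proof.
have rconsP (u : seq T) y z : List.In y (rcons u z) <-> List.In y u \/ z = y.
  by rewrite -cats1 List.in_app_iff /=; split=> -[|[]]; auto; case.
elim: l => [|y l IH] lx; first by exists [::].
have [l' l'P] : exists l' : seq {y | lt y x},
    forall y, List.In y l -> List.In y (rcons (map sval l') x).
  by apply: IH => z zl; apply: lx; right.
have [yx|->] := lx y (or_introl erefl).
- exists (exist _ y yx :: l') => z [<-|/l'P] /=; [by left|by right].
- by exists l' => z [<-|/l'P//]; apply/rconsP; right.
Qed.

(* [new w i] is the new pair of elements at [i] in case [F f i = w]. *)
Lemma stage_step x st (new : W -> I -> A * B) :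
    (forall y, lt y x -> invariant y st) ->
    (forall Psi l, exists Psi', forall i, agreement st Psi' l i -> exists w,
      agree R Q Psi (size l).+1
        (fun k => if k == size l then (new w i).1 else asgA st i l k)
        (fun k => if k == size l then (new w i).2 else asgB st i l k)) ->
  exists f rm, let st' := update st x
      (fun i => (new (F f i) i).1, fun i => (new (F f i) i).2, rm) in
    covered rm (stage_size x) /\
    forall Psi l, (forall y, List.In y l -> le y x) -> consistent st' (le^~ x) Psi l.
Proof.
move=> inv newP; pose C : Type := (seq (formula tau s) * seq {y | lt y x})%type.
have /choice[psi psiP] (c : C) := newP c.1 (map sval c.2).
(* Wherever the earlier pairs agree on the formulas [psi c], [g] selects a value [w] for which the
   new pair keeps agreement on [c.1]. *)
have /choice[g gP] (ci : C * I) : exists w, agreement st (psi ci.1) (map sval ci.1.2) ci.2 ->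
    agree R Q ci.1.1 (size (map sval ci.1.2)).+1
      (fun k => if k == size (map sval ci.1.2) then (new w ci.2).1
        else asgA st ci.2 (map sval ci.1.2) k)
      (fun k => if k == size (map sval ci.1.2) then (new w ci.2).2
        else asgB st ci.2 (map sval ci.1.2) k).
  have [/psiP[w wP]|nag] := pselect (agreement st (psi ci.1) (map sval ci.1.2) ci.2).
    by exists w.
  by exists w0 => /nag.
have Kinf := stage_size_inf x.
have CK : embeds (C * W * option W) (stage_size x).
  have WK := embeds_inr {y | lt y x} W.
  have FK := embeds_seq_inf Kinf (embeds_trans Wfm WK).
  have lK := embeds_seq_inf Kinf (embeds_inl {y | lt y x} W).
  exact: (embeds_prod_inf Kinf (embeds_prod_inf Kinf (embeds_prod_inf Kinf FK lK) WK)
    (embeds_option_inf Kinf WK)).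
have [] := @fresh_function W I T F w0 t0 C
  (fun c => agreement st (psi c) (map sval c.2)) (fun c i => g (c, i))
  (fun t => exists y, lt y x /\ (st y).2 t).
- by apply: embeds_prod_inf (embeds_option_inf _ _); do ?exact: embeds_refl.
- move=> c k v; apply: (consistent_below inv) => y.
  by elim: c.2 => //= z l IH [<-|/IH//]; apply: (svalP z).
- move=> h; have [y yx|f [fx hf]] := @uncovered x (fun y t => lt y x /\ (st y).2 t) _ h _ CK.
    have [yx'|nyx] := pselect (lt y x); last by exists (fun=> t0) => t [/nyx].
    by have [_ [h' h'P] _] := inv y yx'; exists h' => t [_ /h'P].
  by exists f; split=> // -[y [yx ry]]; apply: (fx y); [left|].
move=> f [rm [rmf crm fr]]; exists f, rm => st'; split.
  apply: covered_embeds crm; first exact: None.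
  exact: embeds_option_inf.
move=> Psi l /below_list[l' ll'] k v kav.
have [Psi1 Psi1P] := agree_weaken Psi ll'.
have [|i [agi fi Ffi]] := fr (Psi1, l') k v.
  move=> w [[y [yx ry]]|rw]; apply: (kav w).
    exists y; split; first by left.
    rewrite /st' update_other // => yE.
    by apply: (wf_irrefl lt_wf (x := x)); rewrite -{1}yE.
  by exists x; split; [right|rewrite /st' update_same].
exists i; split=> //; apply: Psi1P; rewrite size_rcons.
have rconsE X (d : X) (a a' : T -> X) c : (forall y, lt y x -> a' y = a y) -> a' x = c ->
    assign d a' (rcons (map sval l') x) =
    (fun k => if k == size (map sval l') then c else assign d a (map sval l') k).
  move=> aa' <-; apply/funext => n; rewrite /assign map_rcons nth_rcons !size_map.
  rewrite -!map_comp (eq_map (g := a \o sval)); last by move=> y; apply: (aa' _ (svalP y)).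
  case: ltngtP => // nl; rewrite nth_default // size_map; exact: ltnW.
have st'E y : lt y x -> st' y = st y.
  move=> yx; rewrite /st' update_other // => yE.
  by apply: (wf_irrefl lt_wf (x := x)); rewrite -{1}yE.
rewrite (rconsE _ _ (fun y => (st y).1.1 i) _ (new (F f i) i).1); last 2 first.
- by move=> y /st'E ->.
- by rewrite /st' update_same.
rewrite (rconsE _ _ (fun y => (st y).1.2 i) _ (new (F f i) i).2); last 2 first.
- by move=> y /st'E ->.
- by rewrite /st' update_same.
by rewrite Ffi; apply: (gP ((Psi1, l'), i)) agi.
Qed.

(** The given element is kept, and its partner takes at [i] the element coded by [F f i], with [f]
    provided by [stage_step]; [piA] and [piB] decode [W] onto the two structures. *)
Lemma stages_exist : exists st, forall x, invariant x st.
Proof.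
have [piA piAP] := embeds_surj (inhab A) WA.
have [piB piBP] := embeds_surj (inhab B) WB.
apply: (wf_choice (fun=> inhab A, fun=> inhab B, fun=> False) lt_wf lt_trans).
  by move=> x st st' E; apply: invariant_local.
move=> x st inv; rewrite /invariant; case: (task x) => [a|b].
- have [|f [rm [crm cons]]] := @stage_step x st (fun w i => (a i, piB w)) inv.
    move=> Psi l; have [Psi' PsiP] := agree_extend (size l) Psi.
    exists Psi' => i /PsiP/(_ (a i))[y agy]; have [w wy] := piBP y.
    by exists w; rewrite wy.
  by exists (a, (fun i => piB (F f i)), rm); rewrite update_same; split.
- have [|f [rm [crm cons]]] := @stage_step x st (fun w i => (piA w, b i)) inv.
    move=> Psi l; have [Psi' PsiP] := agree_extend (size l) Psi.
    exists Psi' => i /agree_sym/PsiP/(_ (b i))[y agy]; have [w wy] := piAP y.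
    by exists w; rewrite wy; apply: agree_sym.
  by exists ((fun i => piA (F f i)), b, rm); rewrite update_same; split.
Qed.

Lemma agreement_proper st : (forall x, invariant x st) ->
  ProperFilter (fun X : set I => exists Psi l, agreement st Psi l `<=` X).
Proof.
move=> inv; split.
  move=> [Psi [l lP]]; have [x lx] : exists x, forall y, List.In y l -> le y x.
    by case: l {lP} => [|y l]; [exists t0|have [m []] := stage_max y l; exists m].
  have [_ _ cons] := inv x.
  (* Consistency asks for a prescription on unspent functions; the constant family at one such [f]
     will do. *)
  have [||f [fx _]] := @uncovered x (fun y => (st y).2) False (fun=> t0).
  - by move=> y _; have [] := inv y.
  - by exists (False_rect _); case.
  have [|i [/lP]] := cons Psi l lx (fun=> f) (fun=> w0); last by [].
  by move=> w [y [yx]]; apply: fx.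
split.
- by exists [::], [::].
- move=> X Y [Psi1 [l1 X1]] [Psi2 [l2 X2]].
  have [|Psi1' P1] := @agree_weaken tau D s T l1 (l1 ++ l2) Psi1.
    by move=> y yl; apply/List.in_or_app; left.
  have [|Psi2' P2] := @agree_weaken tau D s T l2 (l1 ++ l2) Psi2.
    by move=> y yl; apply/List.in_or_app; right.
  exists (Psi1' ++ Psi2'), (l1 ++ l2) => i /agree_cat[ag1 ag2].
  by split; [apply/X1/P1|apply/X2/P2].
- by move=> X Y XY [Psi [l lX]]; exists Psi, l; apply: subset_trans XY.
Qed.

(** Any ultrafilter containing the agreement sets works: [a] is sent to its partner at a stage
    [pos a] where it occurs, and each clause of the isomorphism comes from transferring an atomic
    formula. *)
Lemma iso_ultrapowers_exist : (forall z, exists x, task x = z) ->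
  have_iso_ultrapowers R Q.
Proof.
move=> taskP; have [st inv] := stages_exist.
have [U [uU FU]] := ultraFilterLemma (agreement_proper inv).
have ultU : ultrafilter U.
  split; first exact: filterT.
  split; first exact: filter_not_empty.
  split; first by move=> X Y UX XY; apply: filterS UX.
  by split; [move=> X Y; apply: filterI|move=> X; apply: in_ultra_setVsetC].
have [UT [_ [Umono [Uand _]]]] := ultU.
have transfer phi l : fvars_in (fun n => n < size l) phi ->
    U (fun i => sat R (asgA st i l) phi) <-> U (fun i => sat Q (asgB st i l) phi).
  move=> vphi; have Uag : U (agreement st [:: phi] l) by apply: FU; exists [:: phi], l.
  by split=> H; apply: Umono (Uand _ _ Uag H) _ => i [ag] /(ag phi (or_introl erefl) vphi).
have /choice[pos posP] a : exists x, (st x).1.1 = a.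
  by have [x tx] := taskP (inl a); exists x; have [+ _ _] := inv x; rewrite tx.
exists I, U, I, U; split=> //; split=> //.
exists (fun a => (st (pos a)).1.2); split.
  move=> a b; have := transfer (FEq s (Var tau 0) (Var tau 1)) [:: pos a; pos b] (conj isT isT).
  by rewrite /= /asgA /asgB /assign /= !posP.
split.
  (* The partner of [b] at stage [x] may have another stage as its [pos]; transferring an equality
     shows that its partners at both stages agree on a [U]-large set. *)
  move=> b; have [x tx] := taskP (inr b); exists (st x).1.1.
  have := transfer (FEq s (Var tau 0) (Var tau 1)) [:: pos (st x).1.1; x] (conj isT isT).
  have [+ _ _] := inv x; rewrite tx /= /asgA /asgB /assign /= !posP => -> [+ _].
  by apply; apply: Umono UT _.
pose args n (a : 'I_n -> I -> A) := map (fun k => pos (a k)) (enum 'I_n).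
have size_args n a : size (@args n a) = n by rewrite size_map size_enum_ord.
have nth_args X (d : X) f n a l (k : 'I_n) :
    nth d (map f (@args n a ++ l)) k = f (pos (a k)).
  rewrite map_cat nth_cat size_map size_args ltn_ord -map_comp.
  by rewrite (nth_map k) ?size_enum_ord //= nth_ord_enum.
have argsA n a l i : (fun k : 'I_n => asgA st i (@args n a ++ l) k) = (fun k => a k i).
  by apply/funext => k; rewrite /asgA /assign nth_args posP.
have argsB n a l i : (fun k : 'I_n => asgB st i (@args n a ++ l) k) =
    (fun k => (st (pos (a k))).1.2 i).
  by apply/funext => k; rewrite /asgB /assign nth_args.
split.
  (* The transferred equation has the arguments as its first [farity f] variables and the value [c]
     as the next one. *)
  move=> f a; pose c i := fn (fun k => a k i).
  have [|+ _] := transfer (FEq s (App (fun k : 'I_(farity f) => Var tau k))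
      (Var tau (farity f))) (args _ a ++ [:: pos c]).
    by rewrite size_cat size_args addn1 /=; split=> [k|]; [apply/ltnW/ltn_ord|apply: ltnSn].
  have nthc X (d : X) h : nth d (map h (args _ a ++ [:: pos c])) (farity f) = h (pos c).
    by rewrite map_cat nth_cat size_map size_args ltnn subnn.
  move=> /= Ufn; have {}Ufn := Ufn (Umono _ _ UT _).
  apply: Umono (Ufn _) _ => i; last by rewrite argsB /asgB /assign nthc => ->.
  by move=> _; rewrite argsA /asgA /assign nthc posP.
split.
  move=> r a; have := transfer (FRel s (fun k : 'I_(rarity r) => Var tau k)) (args _ a ++ [::]).
  rewrite cats0 size_args /= => /(_ (fun k => ltn_ord k)).
  have E i := argsA _ a [::] i; have E' i := argsB _ a [::] i; rewrite cats0 in E E'.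
  by under eq_fun do rewrite E; under [in X in _ <-> X]eq_fun do rewrite E'.
move=> r a; have := transfer (FX (fun k : 'I_(s r) => Var tau k)) (args _ a ++ [::]).
rewrite cats0 size_args /= => /(_ (fun k => ltn_ord k)).
have E i := argsA _ a [::] i; have E' i := argsB _ a [::] i; rewrite cats0 in E E'.
by under eq_fun do rewrite E; under [in X in _ <-> X]eq_fun do rewrite E'.
Qed.

End Construction.

(** Here [I] embeds in the power set [L] of [W], so both powers over [I] embed in the power set [T]
    of [L], and every element of them can be assigned a stage. By Cantor, [T] does not embed in
    [W]. *)
Theorem keisler_shelah (tau : signature) (D : Type) (s : D -> nat)
    (A : structure tau) (R : rel_tuple s A) (B : structure tau) (Q : rel_tuple s B) :
  (forall phi, sentence phi -> models R phi <-> models Q phi) ->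
  have_iso_ultrapowers R Q.
Proof.
move=> AB; pose W : Type := (nat + A + B + formula tau s)%type.
pose L := W -> Prop; pose T := L -> Prop; pose I := ifam_index W L.
have nW : embeds nat W.
  apply: embeds_trans (embeds_inl _ _); apply: embeds_trans (embeds_inl _ _).
  exact: embeds_inl.
have AW : embeds A W.
  apply: embeds_trans (embeds_inl _ _); apply: embeds_trans (embeds_inl _ _).
  exact: embeds_inr.
have BW : embeds B W.
  by apply: embeds_trans (embeds_inl _ _); apply: embeds_inr.
have FW : embeds (formula tau s) W by apply: embeds_inr.
have WL : embeds W L by apply: embeds_powset.
have LT : embeds L T by apply: embeds_powset.
have nL := embeds_trans nW WL; have nT := embeds_trans nL LT.
have WW := embeds_square nW.
have WfunL X : embeds X W -> embeds (W -> X) L.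
  move=> XW; apply: embeds_trans (embeds_fun _ _) (embeds_pow _).
  exact: (embeds_prod_inf nW (embeds_refl W) XW).
have powWW : embeds (W * W -> Prop) L by apply: embeds_pow.
have IL : embeds I L.
  apply: (embeds_prod_inf nL (embeds_prod_inf nL _ _) (WfunL _ (embeds_refl W))).
    apply: (@embeds_trans (W * W * W -> Prop)).
      exists (fun f p => f p.1 p.2) => f g fg; apply/funext => p; apply/funext => w.
      exact: (congr1 (@^~ (p, w)) fg).
    by apply/embeds_pow/(embeds_prod_inf nW WW)/embeds_refl.
  apply: (@embeds_trans (W * (W * W) -> Prop)).
    exists (fun f p => f p.1 p.2) => f g fg; apply/funext => p; apply/funext => w.
    exact: (congr1 (@^~ (p, w)) fg).
  exact/embeds_pow/(embeds_prod_inf nW)/WW/embeds_refl.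
have IfunT X : embeds X W -> embeds (I -> X) T.
  move=> XW; apply: embeds_trans (embeds_fun _ _) (embeds_pow _).
  exact: (embeds_prod_inf nL IL (embeds_trans XW WL)).
have [lt ini] := initial_order_exists T.
have TW : ~ embeds T W by move=> TW; apply: (@not_embeds_pow L); apply: embeds_trans TW WL.
have [task taskP] := embeds_surj (inl (fun=> inhab A))
  (embeds_sum_inf nT (IfunT A AW) (IfunT B BW)).
have w0 : W := inl (inl (inl 0)).
apply: (iso_ultrapowers_exist AB w0 (fun=> True) nW AW BW FW (F := ifam w0) _ ini TW taskP).
by move=> k v; apply: ifam_independent => w; apply: True.
Qed.

(** * Types omissions and property (A) *)

Theorem theorem3p13 (tau : signature) (D : Type) (s : D -> nat)
  (HD : infinite_type D) (Hs : each_value_Delta_times s)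
  (K : structure tau -> Prop) :
  axiomatizable_by_types_omissions s K <-> propertyA s K.
Proof.
split=> [[Pi [PiK KPi]] A hA|propA].
  apply: contrapT => /KPi[p [/PiK[_ pK] [R pR]]].
  have [B [Q [KB [I [U [J [V [uU [uV iso]]]]]]]]] := hA R.
  apply: (pK B KB); exists Q => phi; rewrite pR.
  by split=> -[sphi]; have E := iso_ultrapowers_models uU uV iso sphi; split=> //; apply E.
exists (omitted_by_all K); split=> // A nKA.
have [R nR] : exists R : rel_tuple s A, forall B (Q : rel_tuple s B),
    K B -> ~ have_iso_ultrapowers R Q.
  apply: contrapT => nR; apply/nKA/propA => R; apply: contrapT => nBQ; apply: nR.
  by exists R => B Q KB iso; apply: nBQ; exists B, Q.
exists (tp R); split; last by exists R.
split.
  split; first by move=> phi [].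
  split; first by move=> l lR; exists A, R => phi /lR[].
  move=> phi sphi; have [Rphi|nRphi] := pselect (models R phi); first by left.
  by right.
move=> B KB [Q RQ]; apply: (nR B Q KB); apply: keisler_shelah => phi sphi.
have phiP := RQ phi.
by split=> H; [have [] : tp Q phi by apply/phiP|have [] : tp R phi by apply/phiP].
Qed.
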